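(* Let $R=\mathbb{K}[x_1,\dots,x_n]$ with $\mathbb{K}$ a field of characteristic $0$ and let $I\subseteq R$ be an ideal. Suppose that for each associated prime $\mathfrak{p}\in\operatorname{Ass}(R/I)$ we are given (1) elements $\mathbf{t}=(t_1,\dots,t_k)$, $\mathbf{y}=(y_1,\dots,y_{n-k})$ of $R$ forming a regular system of parameters for $R$ (so that $R=\mathbb{K}[\mathbf{t},\mathbf{y}]$), such that the images of $\mathbf{t}$ in $R/\mathfrak{p}$ form a maximal algebraically independent set (the free variables for $\mathfrak{p}$), and (2) a finite set $A_{\mathfrak{p}}\subseteq D_{\mathbb{K}(\mathbf{t})\mathfrak{p}}[\mathbb{K}(\mathbf{t})I]\subseteq\kappa(\mathbb{K}(\mathbf{t})\mathfrak{p})\langle\partial_{\mathbf{y}}\rangle$ whose cosets span the excess dual space $E_{\mathbb{K}(\mathbf{t})\mathfrak{p}}[\mathbb{K}(\mathbf{t})I]$. Then the ideal $I$ can be recovered from $\operatorname{Ass}(R/I)$ together with this data; that is, $I$ is uniquely determined by $\operatorname{Ass}(R/I)$ and the data (1)–(2) for each associated prime.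
   Context: For a prime $\mathfrak{p}$ and $\mathbf{t},\mathbf{y}$ as in (1), write $\mathbb{K}(\mathbf{t})M:=\mathbb{K}(\mathbf{t})\otimes_{\mathbb{K}[\mathbf{t}]}M$ (localization at $\mathbb{K}[\mathbf{t}]\setminus\{0\}$). Thus $S:=\mathbb{K}(\mathbf{t})R\cong\mathbb{K}(\mathbf{t})[\mathbf{y}]$ is a polynomial ring over the field $\mathbb{K}(\mathbf{t})$, $\mathbb{K}(\mathbf{t})I$ and $\mathbb{K}(\mathbf{t})\mathfrak{p}$ are the extended ideals, and $\mathfrak{M}:=\mathbb{K}(\mathbf{t})\mathfrak{p}$ is a maximal ideal of $S$ with residue field $\kappa(\mathfrak{M})=S/\mathfrak{M}$. Local dual spaces over $S$: $\kappa(\mathfrak{M})\langle\partial_{\mathbf{y}}\rangle$ denotes finite sums $D=\sum_\alpha c_\alpha\partial_{\mathbf{y}}^\alpha$ with $c_\alpha\in\kappa(\mathfrak{M})$; for $g\in S$, $D\cdot g=\sum_\alpha c_\alpha\,\overline{\partial_{\mathbf{y}}^\alpha g}\in\kappa(\mathfrak{M})$ (bar = reduction mod $\mathfrak{M}$), and ''$D\cdot g\in\mathfrak{M}$'' means $D\cdot g=0$. For an ideal $J\subseteq S$, $D_{\mathfrak{M}}[J]=\{D\mid D\cdot g\in\mathfrak{M}\ \forall g\in J\}$, a $\kappa(\mathfrak{M})$-vector space. The excess dual space is $E_{\mathfrak{M}}[J]=D_{\mathfrak{M}}[J]/D_{\mathfrak{M}}[J:\mathfrak{M}^\infty]$, where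 $J:\mathfrak{M}^\infty$ is the saturation. *)

(* Defs.v *)
From HB Require Import structures.
From mathcomp Require Import all_boot all_order all_algebra.
From mathcomp Require Import fraction.
From mathcomp.multinomials Require Import mpoly.

Set Implicit Arguments.
Unset Strict Implicit.
Unset Printing Implicit Defensive.

Import Order.TTheory GRing.Theory.
Local Open Scope ring_scope.

Section Ideals.
Variable R : comNzRingType.

Definition is_ideal (I : R -> Prop) : Prop :=
  [/\ I 0, (forall x y, I x -> I y -> I (x + y)) & (forall r x, I x -> I (r * x))].

Definition is_prime_ideal (P : R -> Prop) : Prop :=
  [/\ is_ideal P, ~ P 1 & (forall a b, P (a * b) -> P a \/ P b)].

Definition is_assoc (I P : R -> Prop) : Prop :=
  is_prime_ideal P /\ exists f : R, forall x, P x <-> I (x * f).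

Definition ideal_gen (A : R -> Prop) : R -> Prop :=
  fun x => forall J, is_ideal J -> (forall a, A a -> J a) -> J x.

Definition saturation (J M : R -> Prop) : R -> Prop :=
  fun s => exists N : nat, forall m : 'I_N -> R,
    (forall i, M (m i)) -> J (s * \prod_(i < N) m i).
End Ideals.

Section Coords.
Variables (K : fieldType) (n k : nat).

Definition Kt := {fraction {mpoly K[k]}}.
Definition Sring := {mpoly Kt[n - k]}.
Definition Cring := {mpoly {mpoly K[k]}[n - k]}.
(* local differential operators sum_a c_a d_y^a, coefficients given by
   lifts c_a in S of elements of kappa(M) = S/M *)
Definition dualop := {mpoly Sring[n - k]}.

Variables (t : 'I_k -> {mpoly K[n]}) (y : 'I_(n - k) -> {mpoly K[n]}).

Definition coord_map (G : Cring) : {mpoly K[n]} :=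
  mmap (fun c : {mpoly K[k]} => mmap (@mpolyC n K) t c) y G.

Definition coord_system : Prop := bijective coord_map.

Definition free_vars (P : {mpoly K[n]} -> Prop) : Prop :=
  (forall c : {mpoly K[k]}, P (mmap (@mpolyC n K) t c) -> c = 0) /\
  (forall r : {mpoly K[n]}, exists c : {poly {mpoly K[k]}},
      c != 0 /\ P ((map_poly (mmap (@mpolyC n K) t) c).[r])).

Definition ext_map (G : Cring) : Sring :=
  map_mpoly (fun c : {mpoly K[k]} => (@FracField.tofrac _ c : Kt)) G.

Definition ext_ideal (I : {mpoly K[n]} -> Prop) : Sring -> Prop :=
  ideal_gen (fun s : Sring => exists G : Cring, I (coord_map G) /\ s = ext_map G).

(* D . g  (as a lift in S; "D . g in M" means its class in kappa(M) is 0) *)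
Definition apply_dual (D : dualop) (g : Sring) : Sring :=
  \sum_(m <- msupp D) D@_m * g^`M[m].

Definition dual_space (M J : Sring -> Prop) (D : dualop) : Prop :=
  forall g, J g -> M (apply_dual D g).

(* A \subseteq D_M[K(t)I] and the cosets of A span the excess dual space
   E_M[K(t)I] = D_M[K(t)I] / D_M[K(t)I : M^oo] over kappa(M), where
   M = K(t)P; equality in kappa(M)<d_y> is coefficientwise equality mod M. *)
Definition excess_generators (I P : {mpoly K[n]} -> Prop) (A : seq dualop) : Prop :=
  let M := ext_ideal P in
  let JI := ext_ideal I in
  (forall a, a \in A -> dual_space M JI a) /\
  (forall D, dual_space M JI D ->
     exists (lam : 'I_(size A) -> Sring) (D' : dualop),
       dual_space M (saturation JI M) D' /\
       forall m, M ((D - \sum_(i < size A) lam i *: nth 0 A i - D')@_m)).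
End Coords.

(* Main.v *)
(** Write [I(P)] for the contraction to [R] of [I R_P]. An ideal is the
    intersection of its [I(P)] over its associated primes, so it suffices to show
    [I] is contained in [J(P)] for each associated prime [P] of [J], by induction
    on [P] (finitely many primes, ordered by inclusion). If [f] is in [I], the
    induction hypothesis puts some [s f], [s] outside [P], in the saturation of
    [J] by [P]. If [s f] were not in [J(P)], some operator [D] in the dual space
    of the extension of [J] would not annihilate it; but [D] is a combination of
    elements of [A], which annihilate [I], and of an operator that annihilates
    the saturation of [J].

    The separating [D] is built as follows, in [S = F[y]] with [F = K(t)] and
    [M] the extension of [P]. Enlarge [J] to an [M]-primary ideal [L] with
    [(L : g)] contained in [M], and take an [F]-linear map from [S / L] to
    [kappa(M)] sending [s g] to [s]. Let [p_i(y_i)] in [M] be separable relations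
    and factor [p_i(Y) - p_i(y_i) = (Y - y_i) q_i(Y)] over [kappa(M)]. Since
    [p_i(y_i)^N] lies in [L], letting the product of the [q_i(Y_i)^N] act on the
    map makes it killed by each [(Y_i - y_i)^N], hence a differential operator by
    Taylor's formula, and multiplies its value at [g] by the nonzero
    [p_i'(y_i)^N]. *)

Require Import Defs.
From HB Require Import structures.
From mathcomp Require Import all_boot all_order all_algebra.
From mathcomp Require Import fraction.
From mathcomp.multinomials Require Import ssrcomplements mpoly.
From mathcomp Require Import ring.
From Stdlib Require Import Classical ClassicalEpsilon.

Set Implicit Arguments.
Unset Strict Implicit.
Unset Printing Implicit Defensive.

Import Order.TTheory GRing.Theory.
Local Open Scope ring_scope.

(** * Associated primes in noetherian rings *)

Section Noetherian.
Variable R : comNzRingType.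
Implicit Types (I J L P Q : R -> Prop) (T : R -> Prop).

(** The maximal condition, with maximality phrased as an inclusion, so that no extensional equality
    of predicates is involved. *)
Definition noetherian := forall C : (R -> Prop) -> Prop,
  (exists2 L, is_ideal L & C L) ->
  exists L, [/\ is_ideal L, C L & forall L', is_ideal L' -> C L' ->
    (forall x, L x -> L' x) -> forall x, L' x -> L x].

Lemma ideal0 I : is_ideal I -> I 0.
Proof. by case. Qed.

Lemma idealD I x y : is_ideal I -> I x -> I y -> I (x + y).
Proof. by case=> _ h _; apply: h. Qed.

Lemma idealMl I r x : is_ideal I -> I x -> I (r * x).
Proof. by case=> _ _ h; apply: h. Qed.

Lemma idealMr I r x : is_ideal I -> I x -> I (x * r).
Proof. by rewrite mulrC; apply: idealMl. Qed.

Lemma idealN I x : is_ideal I -> I x -> I (- x).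
Proof. by move=> hI hx; rewrite -mulN1r; apply: idealMl. Qed.

Lemma idealB I x y : is_ideal I -> I x -> I y -> I (x - y).
Proof. by move=> hI hx hy; apply: idealD => //; apply: idealN. Qed.

Lemma ideal_sum I (A : Type) (r : seq A) (p : pred A) (F : A -> R) :
  is_ideal I -> (forall i, p i -> I (F i)) -> I (\sum_(i <- r | p i) F i).
Proof.
by move=> hI h; elim/big_ind: _ => //; [exact: ideal0 | move=> *; exact: idealD].
Qed.

Definition adjoin L x : R -> Prop := fun z => exists a b, L a /\ z = a + b * x.

Lemma adjoin_ideal L x : is_ideal L -> is_ideal (adjoin L x).
Proof.
move=> hL; split.
- by exists 0, 0; rewrite mul0r addr0; split=> //; apply: ideal0.
- move=> _ _ [a [b [ha ->]]] [c [d [hc ->]]]; exists (a + c), (b + d).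
  by split; [apply: idealD | ring].
- move=> r _ [a [b [ha ->]]]; exists (r * a), (r * b).
  by split; [apply: idealMl | ring].
Qed.

Lemma sub_adjoin L x z : L z -> adjoin L x z.
Proof. by move=> hz; exists z, 0; rewrite mul0r addr0. Qed.

Lemma mem_adjoin L x : is_ideal L -> adjoin L x x.
Proof. by move=> hL; exists 0, 1; rewrite mul1r add0r; split=> //; apply: ideal0. Qed.

Definition colon L x : R -> Prop := fun z => L (z * x).

Lemma colon_ideal L x : is_ideal L -> is_ideal (colon L x).
Proof.
move=> hL; rewrite /colon; split.
- by rewrite mul0r; apply: ideal0.
- by move=> a b ha hb; rewrite mulrDl; apply: idealD.
- by move=> r a ha; rewrite -mulrA; apply: idealMl.
Qed.

Definition mul_closed T := T 1 /\ forall a b, T a -> T b -> T (a * b).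

(* The contraction to [R] of the extension of [L] to the localization at [T]. *)
Definition contraction T L : R -> Prop := fun x => exists2 t, T t & L (t * x).

Lemma contraction_ideal T L : mul_closed T -> is_ideal L -> is_ideal (contraction T L).
Proof.
move=> [T1 TM] hL; split.
- by exists 1 => //; rewrite mulr0; apply: ideal0.
- move=> x y [s hs hx] [t ht hy]; exists (s * t); first exact: TM.
  by rewrite mulrDr -{1}[s * t]mulrC -!mulrA; apply: idealD => //; apply: idealMl.
- by move=> r x [t ht hx]; exists t => //; rewrite mulrCA; apply: idealMl.
Qed.

Lemma sub_contraction T L x : mul_closed T -> L x -> contraction T L x.
Proof. by case=> T1 _ hx; exists 1 => //; rewrite mul1r. Qed.

Lemma prime_mul_closed P : is_prime_ideal P -> mul_closed (fun s => ~ P s).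
Proof. by case=> _ P1 PM; split=> // a b ha hb /PM[]. Qed.

Lemma prime_expr P x k : is_prime_ideal P -> P (x ^+ k) -> P x.
Proof.
by case=> _ P1 PM; elim: k => [|k IH]; rewrite ?expr0 // exprS => /PM[].
Qed.

Lemma assoc_prime J P : is_assoc J P -> is_prime_ideal P.
Proof. by case. Qed.

Hypothesis noethR : noetherian.

Lemma noetherian_ind (C : (R -> Prop) -> Prop) :
  (forall L, is_ideal L ->
    (forall L', is_ideal L' -> (forall x, L x -> L' x) ->
       (exists2 x, L' x & ~ L x) -> C L') -> C L) ->
  forall L, is_ideal L -> C L.
Proof.
move=> step L hL; apply: NNPP => nCL.
have [|M [hM nCM maxM]] := @noethR (fun L => ~ C L); first by exists L.
apply: nCM; apply: step => // L' hL' sub [x hx nx].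
by apply: NNPP => nCL'; apply/nx/(maxM L').
Qed.

(** This is the common denominator of a finitely generated ideal, obtained from a maximal subideal
    of [L] that has one multiplier. *)
Lemma contraction_uniform T L W : mul_closed T -> is_ideal L -> is_ideal W ->
  (forall x, L x -> contraction T W x) ->
  exists2 t, T t & forall x, L x -> W (t * x).
Proof.
move=> hT hL hW sub; have [T1 TM] := hT.
pose C L' := (forall x, L' x -> L x) /\ exists2 t, T t & forall x, L' x -> W (t * x).
have [|M [hM [ML [t ht tW]] maxM]] := @noethR C.
  exists (fun x => x = 0).
    by split=> [//|_ _ -> ->|r _ ->]; rewrite ?addr0 ?mulr0.
  split; first by move=> _ ->; apply: ideal0.
  by exists 1 => // _ ->; rewrite mulr0; apply: ideal0.
exists t => // x hx; have [s hs sx] := sub _ hx.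
apply: (tW); apply: (maxM (adjoin M x)); first exact: adjoin_ideal.
- split=> [_ [a [b [ha ->]]]|].
    by apply: idealD => //; [apply: ML | apply: idealMl].
  exists (s * t); first exact: TM.
  move=> _ [a [b [ha ->]]].
  have -> : s * t * (a + b * x) = s * (t * a) + (t * b) * (s * x) by ring.
  by apply: idealD => //; apply: idealMl => //; apply: tW.
- by move=> z hz; apply: sub_adjoin.
- exact: mem_adjoin.
Qed.

(** In the localization at [T], a maximal annihilator among those of nonzero multiples [r * h] is
    prime. A uniform denominator [t] makes it the annihilator modulo [J] of the element
    [t * (r * h)] of [R]. *)
Lemma exists_assoc_avoiding T J h : mul_closed T -> is_ideal J ->
  ~ contraction T J h ->
  exists Q, [/\ is_assoc J Q, forall t, T t -> ~ Q t & forall x, J (x * h) -> Q x].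
Proof.
move=> hT hJ hh; have [T1 TM] := hT.
have hc := contraction_ideal hT hJ.
pose C L := exists r, [/\ ~ contraction T J (r * h),
  (forall x, L x -> contraction T J (x * (r * h))) &
  (forall x, contraction T J (x * (r * h)) -> L x)].
have colC r : ~ contraction T J (r * h) -> C (colon (contraction T J) (r * h)).
  by move=> hr; exists r.
have [|Q [hQ [r [hr Q1 Q2]] maxQ]] := @noethR C.
  exists (colon (contraction T J) (1 * h)); first exact: colon_ideal.
  by apply: colC; rewrite mul1r.
have [||t ht tQ] := @contraction_uniform T Q (colon J (r * h)) hT hQ.
- exact: colon_ideal.
- by move=> x /Q1 [t ht htx]; exists t => //; rewrite /colon -mulrA.
have QE x : Q x <-> J (x * (t * (r * h))).
  have e : x * (t * (r * h)) = t * x * (r * h) by ring.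
  rewrite e; split=> [/tQ //|htx]; apply: Q2; exists t => //.
  by rewrite mulrA.
exists Q; split.
- split; last by exists (t * (r * h)).
  split=> // [/Q1|a b /Q1 hab]; first by rewrite mul1r.
  have [|na] := classic (Q a); [by left | right].
  have nar : ~ contraction T J (a * r * h) by move=> har; apply/na/Q2; rewrite mulrA.
  apply: (maxQ _ (colon_ideal _ hc) (colC _ nar)).
    move=> x /Q1 hx; rewrite /colon.
    have -> : x * (a * r * h) = a * (x * (r * h)) by ring.
    exact: idealMl.
  by rewrite /colon; have -> : b * (a * r * h) = a * b * (r * h) by ring.
- move=> s hs /Q1 [u hu hus]; apply: hr; exists (u * s); first exact: TM.
  by rewrite -mulrA.
- move=> x hx; apply: Q2; apply: sub_contraction => //.
  by rewrite mulrCA; apply: idealMl.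
Qed.

(** Noetherian induction, with [P] the colon of [J] by [f] and [Q] that by [h]. If a multiple of [h]
    outside [J] lies in [J + (f)], its annihilator is both [Q] and [P]; otherwise [Q] is also
    associated to [J + (f)]. *)
Lemma assoc_finite J : is_ideal J ->
  exists l : seq (R -> Prop), forall Q, is_assoc J Q ->
    exists2 P, List.In P l & forall x, P x <-> Q x.
Proof.
move: J; apply: noetherian_ind => J hJ IH.
have [[P [[hP P1 PM] [f hf]]]|noP] := classic (exists P, is_assoc J P); last first.
  by exists [::] => Q hQ; case: noP; exists Q.
have [||l hl] := IH (adjoin J f) (adjoin_ideal _ hJ).
- by move=> x hx; apply: sub_adjoin.
- by exists f; [apply: mem_adjoin | move=> h; apply: P1; apply/hf; rewrite mul1r].
exists (P :: l) => Q [[hQ Q1 QM] [h hh]].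
have [[r [nr [s [i [hi e]]]]]|nor] := classic (exists r, ~ J (r * h) /\
   exists s i, J i /\ r * h = i + s * f).
  exists P; first by left.
  have nQr : ~ Q r by move/hh.
  have nPs : ~ P s by move/hf => hs; apply: nr; rewrite e; apply: idealD.
  move=> x; split=> hx.
    have : Q (r * x).
      apply/hh; have -> : r * x * h = x * (r * h) by ring.
      rewrite e mulrDr; apply: idealD => //; first exact: idealMl.
      by rewrite mulrCA; apply: idealMl => //; apply/hf.
    by case/QM.
  have : P (s * x).
    apply/hf; have -> : s * x * f = r * (x * h) - x * i.
      by rewrite [r * _]mulrCA e; ring.
    by apply: idealB => //; apply: idealMl => //; apply/hh.
  by case/PM.
have [|P' lP' hP'] := hl Q.
  split=> //; exists h => x; rewrite hh; split; first exact: sub_adjoin.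
  move=> [i [s [hi e]]]; apply: NNPP => nx; apply: nor; exists x; split=> //.
  by exists s, i.
by exists P' => //; right.
Qed.

Lemma assoc_ind J (C : (R -> Prop) -> Prop) : is_ideal J ->
  (forall P, is_assoc J P ->
    (forall Q, is_assoc J Q -> (forall x, Q x -> P x) ->
       (exists2 x, P x & ~ Q x) -> C Q) -> C P) ->
  forall P, is_assoc J P -> C P.
Proof.
move=> hJ step; have [l hl] := assoc_finite hJ.
(* The induction is on the length of a list covering the primes strictly below [P]; passing to such
   a [Q] removes it from the list. *)
suff: forall k (l : seq (R -> Prop)) P, size l = k -> is_assoc J P ->
   (forall Q, is_assoc J Q -> (forall x, Q x -> P x) -> (exists2 x, P x & ~ Q x) ->
     exists2 P', List.In P' l & forall x, P' x <-> Q x) -> C P.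
  by move=> h P hP; apply: (h _ l P erefl hP) => Q hQ _ _; apply: hl.
elim=> [|k IH] {hl}l P sl hP hl; apply: step => // Q hQ QP PQ.
  by have [P'] := hl Q hQ QP PQ; case: l sl {hl}.
have [P' lP' hP'] := hl Q hQ QP PQ.
have [l1 [l2 e]] := @List.in_split _ P' l lP'.
apply: (IH (l1 ++ l2) Q) => //.
  by move: sl; rewrite e !size_cat /= addnS => -[].
move=> Q' hQ' Q'Q [x Qx nQ'x].
have [||P'' lP'' hP''] := hl Q' hQ'.
- by move=> z /Q'Q/QP.
- by exists x => //; apply: QP.
exists P'' => //; move: lP''; rewrite e.
move=> lP''; have [h|[h|h]] := List.in_app_or _ _ _ lP''.
- by apply: List.in_or_app; left.
- by case: nQ'x; apply/hP''; rewrite -h; apply/hP'.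
- by apply: List.in_or_app; right.
Qed.

(** If [f] is not in [J], the colon of [J] by [f] lies in some associated prime. *)
Lemma ideal_mem_of_assoc J f : is_ideal J ->
  (forall P, is_assoc J P -> exists2 s, ~ P s & J (s * f)) -> J f.
Proof.
move=> hJ h; apply: NNPP => nf.
have [|||P [hP _ sub]] := @exists_assoc_avoiding (fun t => t = 1) J f => //.
- by split=> // _ _ -> ->; rewrite mulr1.
- by case=> _ ->; rewrite mul1r.
by have [s ns /sub] := h P hP.
Qed.

(** Noetherian induction on [B]: for [q] in [P] outside [B] with [q * q] in [B], both [B + (q)] and
    the colon of [B] by [q] are larger, and their product lies in [B]. *)
Lemma radical_power P B : is_ideal P -> is_ideal B ->
  (forall p, P p -> exists n, B (p ^+ n)) ->
  exists N, forall m : 'I_N -> R, (forall i, P (m i)) -> B (\prod_(i < N) m i).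
Proof.
move=> hP; move: B; apply: noetherian_ind => B hB IH rad.
have [[p [hp np]]|no] := classic (exists p, P p /\ ~ B p); last first.
  exists 1%N => m hm; rewrite big_ord1; apply: NNPP => nm.
  by apply: no; exists (m ord0).
(* The last power of [p] outside [B] serves as [q]. *)
have [q [hq nq hqq]] : exists q, [/\ P q, ~ B q & B (q * q)].
  have [n hn] := rad p hp.
  have {hn} : B (p ^+ n.+1) by rewrite exprS; apply: idealMl.
  elim: n => [//|n IHn hn]; have [/IHn //|nn] := classic (B (p ^+ n.+1)).
  exists (p ^+ n.+1); split=> //; first by rewrite exprSr; apply: idealMl.
  by rewrite {2}exprSr mulrA [_ * p]mulrC mulrA -exprS mulrC; apply: idealMl.
have sub1 x : B x -> adjoin B q x by exact: sub_adjoin.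
have sub2 x : B x -> colon B q x by move=> h; apply: idealMr.
have [//|||N1 h1] := IH _ (adjoin_ideal q hB).
- by exists q => //; apply: mem_adjoin.
- by move=> x /rad[n hn]; exists n; apply: sub1.
have [//|||N2 h2] := IH _ (colon_ideal q hB).
- by exists q.
- by move=> x /rad[n hn]; exists n; apply: sub2.
exists (N1 + N2)%N => m hm; rewrite big_split_ord /=.
have [a [b [ha ->]]] := h1 _ (fun i => hm (lshift N2 i)).
have := h2 _ (fun i => hm (rshift N1 i)); rewrite /colon; set z := \prod_i _ => hz.
have -> : (a + b * q) * z = z * a + b * (z * q) by ring.
by apply: idealD => //; apply: idealMl.
Qed.

(** The claim is that, locally at [P], the colon of [J] by [f] contains a power of [P]. If no power
    of some [p] in [P] were in it, an associated prime avoiding [p] and the complement of [P] would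
    contain this colon, while lying strictly below [P]. *)
Lemma saturation_away_from_assoc J P f : is_ideal J -> is_prime_ideal P ->
  (forall Q, is_assoc J Q -> (forall x, Q x -> P x) -> (exists2 x, P x & ~ Q x) ->
     exists2 s, ~ Q s & J (s * f)) ->
  exists2 s, ~ P s & saturation J P (s * f).
Proof.
move=> hJ pP hQ; have [hP P1 PM] := pP.
have mcP := prime_mul_closed pP.
pose B := contraction (fun s => ~ P s) (colon J f).
have hB : is_ideal B by apply/contraction_ideal/colon_ideal.
have rad p : P p -> exists n, B (p ^+ n).
  move=> hp; apply: NNPP => no.
  pose T x := exists n s, ~ P s /\ x = s * p ^+ n.
  have TP s : ~ P s -> T s by move=> hs; exists 0%N, s; rewrite expr0 mulr1.
  have [||Q [aQ TQ subQ]] := @exists_assoc_avoiding T J f _ hJ.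
  - split; first exact: TP.
    move=> _ _ [n [s [hs ->]]] [n' [s' [hs' ->]]]; exists (n + n')%N, (s * s').
    by split; [exact: (proj2 mcP) | rewrite exprD; ring].
  - by move=> [_ [n [s [hs ->]]] h]; apply: no; exists n, s.
  have [||s ns hs] := hQ Q aQ.
  - by move=> x Qx; apply: NNPP => /TP/TQ.
  - by exists p => //; apply: TQ; exists 1%N, 1; rewrite mul1r expr1.
  - exact/ns/subQ.
have [N hN] := radical_power hP hB rad.
have [s ns hs] := contraction_uniform mcP hB (colon_ideal f hJ) (fun x h => h).
exists s => //; exists N => m hm.
rewrite mulrAC; exact/hs/hN.
Qed.

End Noetherian.

(** * Primary ideals avoiding an element *)

Section IdealLemmas.
Variable R : comNzRingType.
Implicit Types (J L P : R -> Prop).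

Lemma ideal_prod_sub L (A : Type) (r : seq A) (E E' : A -> R) : is_ideal L ->
  (forall i, L (E i - E' i)) -> L (\prod_(i <- r) E i - \prod_(i <- r) E' i).
Proof.
move=> hL h; elim/big_rec2: _ => [|i x y _ IH]; first by rewrite subrr; apply: ideal0.
have -> : E i * y - E' i * x = E i * (y - x) + (E i - E' i) * x by ring.
by apply: idealD => //; [apply: idealMl | apply: idealMr].
Qed.

Lemma ideal_lincomb_sub L c u v w z : is_ideal L -> L (u - w) -> L (v - z) ->
  L (c * u + v - (c * w + z)).
Proof.
move=> hL huw hvz; have -> : c * u + v - (c * w + z) = c * (u - w) + (v - z) by ring.
by apply: idealD => //; apply: idealMl.
Qed.

Lemma ideal_of_sub L x y : is_ideal L -> L (x - y) -> L y -> L x.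
Proof. by move=> hL h hy; rewrite -(subrK y x); apply: idealD. Qed.

Lemma ideal_of_sub_r L x y : is_ideal L -> L (x - y) -> L x -> L y.
Proof. by move=> hL h hx; rewrite -(subKr x y); apply: idealB. Qed.

(* An ideal [L] maximal among those containing [J] whose localization at [P]
   misses [g] is irreducible in the localization, hence [P]-primary. *)
Lemma exists_primary_avoiding (noethR : noetherian R) J P g :
  is_prime_ideal P -> is_ideal J -> ~ contraction (fun s => ~ P s) J g ->
  exists L, [/\ is_ideal L, forall x, J x -> L x,
    forall m, P m -> exists k, L (m ^+ k) & forall u, L (u * g) -> P u].
Proof.
move=> pP hJ ng; have [hP P1 PM] := pP.
have mcP := prime_mul_closed pP; have [_ nPM] := mcP.
pose C0 L := (forall x, J x -> L x) /\ ~ contraction (fun s => ~ P s) L g.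
have [|L [hL [JL nL] maxL]] := noethR C0; first by exists J.
have big L' : is_ideal L' -> (forall x, L x -> L' x) -> (exists2 x, L' x & ~ L x) ->
    contraction (fun s => ~ P s) L' g.
  move=> hL' sub [x hx nx]; apply: NNPP => nL'.
  by apply/nx/(maxL L') => //; split=> // z /JL/sub.
have bigA x : ~ L x -> exists s l r, [/\ ~ P s, L l & s * g = l + r * x].
  move=> nx; have [|||s hs [l [r [hl e]]]] := big (adjoin L x).
  - exact: adjoin_ideal.
  - by move=> z; apply: sub_adjoin.
  - by exists x => //; apply: mem_adjoin.
  - by exists s, l, r.
(* By maximality, [L] equals its contraction from the localization at [P]. *)
have sat s x : ~ P s -> L (s * x) -> L x.
  move=> hs hsx; apply: NNPP => /bigA [t [l [r [ht hl e]]]].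
  apply: nL; exists (s * t); first exact: nPM.
  rewrite -mulrA e mulrDr mulrCA; apply: idealD => //; exact: idealMl.
exists L; split=> // [m hm|u hu]; last by apply: NNPP => nu; apply: nL; exists u.
apply: NNPP => no.
have nok k : ~ L (m ^+ k) by move=> h; apply: no; exists k.
(* Otherwise [L : m] and [L + (m ^+ j)] both contain multiples of [g] by elements outside [P]. Where
   the chain of colons [L : m ^+ j] is stationary, their intersection is [L], which contradicts
   [nL]. *)
have reg x : L (m * x) -> L x.
  move=> hmx; apply: NNPP => nx.
  have [|B [hB [j ej] maxB]] := noethR (fun B => exists j, B = colon L (m ^+ j)).
    by exists (colon L (m ^+ 0)); [apply: colon_ideal | exists 0%N].
  have stab z : L (z * m ^+ j.+1) -> L (z * m ^+ j).
    move=> hz; have := maxB (colon L (m ^+ j.+1)); rewrite ej; apply => //.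
    - exact: colon_ideal.
    - by exists j.+1.
    - by move=> w hw; rewrite /colon exprS mulrCA; apply: idealMl.
  have [|||s hs sg] := big (colon L m).
  - exact: colon_ideal.
  - by move=> z hz; apply: idealMr.
  - by exists x => //; rewrite /colon mulrC.
  have [t [l [r [ht hl e]]]] := bigA _ (nok j).
  apply: nL; exists (s * t); first exact: nPM.
  have -> : s * t * g = s * l + s * r * m ^+ j by rewrite -mulrA e; ring.
  apply: idealD => //; first exact: idealMl.
  apply: stab; have -> : s * r * m ^+ j.+1 = t * (s * g * m) - s * m * l.
    have -> : t * (s * g * m) = s * m * (t * g) by ring.
    by rewrite e exprS; ring.
  by apply: idealB => //; apply: idealMl.
have regX k x : L (m ^+ k * x) -> L x.
  by elim: k => [|k IH]; rewrite ?expr0 ?mul1r // exprS -mulrA => /reg.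
(* Locally [r] stands for the quotient of [g] by [m ^+ i] modulo [L]. The ideals [L + (r)] grow with
   [i], and where they stabilize Nakayama's argument puts the next quotient [r'] in [L]. *)
pose C B := exists i s r, [/\ ~ P s, L (s * g - r * m ^+ i) &
  B = contraction (fun s => ~ P s) (adjoin L r)].
have exC i : exists s r, ~ P s /\ L (s * g - r * m ^+ i).
  have [s [l [r [hs hl e]]]] := bigA _ (nok i); exists s, r; split=> //.
  by rewrite e addrK.
have [|B [hB [i [s [r [hs hr eB]]]] maxB]] := noethR C.
  have [s [r [hs hr]]] := exC 0%N.
  exists (contraction (fun s => ~ P s) (adjoin L r)).
    exact/contraction_ideal/adjoin_ideal.
  by exists 0%N, s, r.
have [s' [r' [hs' hr']]] := exC i.+1.
have key : L (s' * r - s * r' * m).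
  apply: (regX i).
  have -> : m ^+ i * (s' * r - s * r' * m) =
      s * (s' * g - r' * m ^+ i.+1) - s' * (s * g - r * m ^+ i).
    by rewrite exprS; ring.
  by apply: idealB => //; apply: idealMl.
have : contraction (fun s => ~ P s) (adjoin L r) r'.
  rewrite -eB; apply: (maxB (contraction (fun s => ~ P s) (adjoin L r'))).
  - exact/contraction_ideal/adjoin_ideal.
  - by exists i.+1, s', r'.
  - move=> z; rewrite eB => -[t ht [a [b [ha e]]]].
    exists (s' * t); first exact: nPM.
    exists (s' * a + b * (s' * r - s * r' * m)), (b * s * m); split.
      by apply: idealD => //; apply: idealMl.
    by rewrite -mulrA e; ring.
  - by apply: sub_contraction => //; apply: mem_adjoin.
move=> [t ht [a [b [ha e]]]].
have Lr' : L r'.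
  apply: (sat (s' * t - b * s * m)).
    move=> h; apply: (nPM s' t) => //.
    rewrite -[s' * t](subrK (b * s * m)); apply: idealD => //.
    exact: idealMl.
  have -> : (s' * t - b * s * m) * r' = s' * (t * r') - b * s * m * r' by ring.
  rewrite e; have -> : s' * (a + b * r) - b * s * m * r' =
    s' * a + b * (s' * r - s * r' * m) by ring.
  by apply: idealD => //; apply: idealMl.
apply: nL; exists s' => //; rewrite -[s' * g](subrK (r' * m ^+ i.+1)).
by apply: idealD => //; apply: idealMr.
Qed.

End IdealLemmas.

(** * Polynomial rings over a field *)

Lemma functional_choice (A B : Type) (P : A -> B -> Prop) :
  (forall x, exists y, P x y) -> exists f : A -> B, forall x, P x (f x).
Proof.
move=> h; exists (fun x => sval (constructive_indefinite_description _ (h x))).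
by move=> x; apply: svalP.
Qed.

(** Each tail of [u] attains its minimum; minimizing indices are chosen successively, each beyond
    the previous one. *)
Lemma nondecreasing_subsequence (u : nat -> nat) :
  exists2 phi : nat -> nat, {homo phi : i j / (i < j)%N} &
    {homo (fun i => u (phi i)) : i j / (i <= j)%N}.
Proof.
have min N : exists m, (N <= m)%N /\ forall j, (N <= j)%N -> (u m <= u j)%N.
  suff: forall k m, (N <= m)%N -> (u m <= k)%N ->
    exists m, (N <= m)%N /\ forall j, (N <= j)%N -> (u m <= u j)%N.
    by move=> h; apply: (h (u N) N).
  elim=> [|k IH] m hm hk.
    by exists m; split=> // j _; apply: leq_trans hk _.
  have [h|h] := classic (forall j, (N <= j)%N -> (u m <= u j)%N); first by exists m.
  have [j hj] := not_all_ex_not _ _ h.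
  have [Nj /negP] := imply_to_and _ _ hj; rewrite -ltnNge => lj.
  by apply: (IH j) => //; rewrite -ltnS; apply: leq_trans lj hk.
have [pick pickP] := functional_choice min.
pose phi := fix phi i := if i is i'.+1 then pick (phi i').+1 else pick 0%N.
have phiE i : exists2 N, (N <= phi i)%N & forall j, (N <= j)%N -> (u (phi i) <= u j)%N.
  case: i => [|i]; first by case: (pickP 0%N) => h1 h2; exists 0%N.
  by case: (pickP (phi i).+1) => h1 h2; exists (phi i).+1.
have phiS i : (phi i < phi i.+1)%N by case: (pickP (phi i).+1).
exists phi; first by apply: (homo_ltn ltn_trans) => i; apply: phiS.
apply: (homo_leq leqnn) => [a b c|i]; first exact: leq_trans.
have [N hN hu] := phiE i; apply: hu.
by apply: leq_trans hN _; apply: ltnW.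
Qed.

(** Passing to subsequences makes the coordinates nondecreasing one after the other. *)
Lemma dickson n (v : nat -> 'X_{1..n}) :
  exists i j, (i < j)%N /\ (v i <= v j)%MM.
Proof.
suff: forall k, exists2 phi : nat -> nat, {homo phi : i j / (i < j)%N} &
    forall l : 'I_n, (l < k)%N -> {homo (fun i => v (phi i) l) : i j / (i <= j)%N}.
  move=> /(_ n) [phi hphi mono]; exists (phi 0%N), (phi 1%N); split; first exact: hphi.
  by apply/mnm_lepP => l; apply: (mono l).
elim=> [|k [phi hphi mono]]; first by exists id.
have [lt_kn|le_nk] := ltnP k n; last first.
  by exists phi => // l _; apply: mono; apply: leq_trans le_nk.
have [psi hpsi mono'] := nondecreasing_subsequence (fun i => v (phi i) (Ordinal lt_kn)).
exists (phi \o psi); first by move=> i j /hpsi/hphi.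
move=> l; rewrite ltnS leq_eqVlt => /orP[/eqP e|lt] i j le_ij /=.
  by have -> : l = Ordinal lt_kn; [exact: val_inj | exact: mono'].
apply: (mono l lt); move: le_ij; rewrite leq_eqVlt => /orP[/eqP -> //|].
by move=> /hpsi /ltnW.
Qed.

Section MpolyField.
Variables (F : fieldType) (n : nat).
Implicit Types (p q : {mpoly F[n]}) (L : {mpoly F[n]} -> Prop).

Lemma mlead_sub_lt p q : mlead p = mlead q -> mleadc p = mleadc q ->
  p - q != 0 -> (mlead (p - q) < mlead p)%O.
Proof.
move=> em ec nz; rewrite lt_neqAle; apply/andP; split; last first.
  by apply: le_trans (mleadB_le _ _) _; rewrite leUx lexx em lexx.
apply/negP => /eqP e; move: nz; rewrite -mleadc_eq0 e mcoeffB ec em subrr.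
by rewrite eqxx.
Qed.

Lemma mpoly_exists_min_mlead L : (exists p, L p) ->
  exists2 p, L p & forall q, L q -> ~~ (mlead q < mlead p)%O.
Proof.
move=> [p]; elim/mleadrect: p => p IH hp.
have [[q [hq lt]]|no] := classic (exists q, L q /\ (mlead q < mlead p)%O).
  exact: (IH q).
by exists p => // q hq; apply/negP => lt; apply: no; exists q.
Qed.

(** Along a strictly increasing chain, [u i] has minimal leading monomial among the elements gained
    at step [i]. By Dickson's lemma one leading monomial divides a later one, and cancelling the
    latter yields a smaller gained element. *)
Lemma mpoly_noetherian : noetherian {mpoly F[n]}.
Proof.
move=> C [L0 hL0 CL0]; apply: NNPP => nomax.
pose X := {L | is_ideal L /\ C L}.
have next (A : X) : exists B : X, (forall x, sval A x -> sval B x) /\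
    exists x, sval B x /\ ~ sval A x.
  case: A => L [hL CL]; apply: NNPP => no; apply: nomax; exists L; split=> //.
  move=> L' hL' CL' sub x hx; apply: NNPP => nx.
  by apply: no; exists (exist _ L' (conj hL' CL')); split=> //; exists x.
have [nxt nxtP] := functional_choice next.
pose Ls := fix Ls i : X := if i is i'.+1 then nxt (Ls i')
                        else exist _ L0 (conj hL0 CL0).
have idL i : is_ideal (sval (Ls i)) by case: (Ls i) => ? [].
have mono i j : (i <= j)%N -> forall x, sval (Ls i) x -> sval (Ls j) x.
  elim: j => [|j IH]; first by rewrite leqn0 => /eqP ->.
  rewrite leq_eqVlt => /orP[/eqP -> //|lt x hx].
  by apply: (proj1 (nxtP (Ls j))); apply: IH.
have exu i : exists p, (sval (Ls i.+1) p /\ ~ sval (Ls i) p) /\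
    forall q, sval (Ls i.+1) q /\ ~ sval (Ls i) q -> ~~ (mlead q < mlead p)%O.
  by case: (mpoly_exists_min_mlead (proj2 (nxtP (Ls i)))) => p; exists p.
have [u uP] := functional_choice exu.
have nzu i : u i != 0.
  by apply/eqP => e; apply: (proj2 (proj1 (uP i))); rewrite e; apply: ideal0.
have [i [j [lt le]]] := dickson (fun i => mlead (u i)).
pose c := mleadc (u j) / mleadc (u i).
pose q := c *: 'X_[mlead (u j) - mlead (u i)] * u i.
have nzc : c != 0 by rewrite mulf_neq0 ?invr_eq0 ?mleadc_eq0.
have lX : mlead (c *: 'X_[F, mlead (u j) - mlead (u i)]) = (mlead (u j) - mlead (u i))%MM.
  by rewrite mleadZ // mleadXm.
have nzX : c *: 'X_[F, mlead (u j) - mlead (u i)] != 0.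
  by rewrite -mleadc_eq0 lX mcoeffZ mcoeffX eqxx mulr1.
have lq : mlead q = mlead (u j) by rewrite mleadM // lX submK.
have lcq : mleadc q = mleadc (u j).
  rewrite lq -{1}(submK le) -{1}lX mleadcM lX mcoeffZ mcoeffX eqxx mulr1.
  by rewrite divfK // mleadc_eq0.
have [[hj nj] minj] := uP j.
have qj : sval (Ls j) q.
  by apply: idealMl => //; apply: (mono i.+1 j lt); case: (uP i) => [[]].
have nj' : ~ sval (Ls j) (u j - q).
  by move=> h; apply: nj; rewrite -(subrK q (u j)); apply: idealD.
have lt' : (mlead (u j - q) < mlead (u j))%O.
  apply: mlead_sub_lt => //.
  by apply/eqP => e; apply: nj'; rewrite e; apply: ideal0.
suff : ~~ (mlead (u j - q) < mlead (u j))%O by rewrite lt'.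
apply: minj; split=> //.
by apply: idealB => //; apply: (mono j j.+1).
Qed.

(* The projection subtracts from [p] its reduction modulo [U], which has no
   monomial among the leading monomials of [U]; hence it is unique, so linear
   in [p]. *)
Lemma subspace_projection (U : {mpoly F[n]} -> Prop) :
  U 0 -> (forall c p q, U p -> U q -> U (c *: p + q)) ->
  exists pi : {mpoly F[n]} -> {mpoly F[n]},
    [/\ forall p, U (pi p), forall p, U p -> pi p = p &
        forall c p q, pi (c *: p + q) = c *: pi p + pi q].
Proof.
move=> U0 UL.
have UZ c p : U p -> U (c *: p) by move=> hp; rewrite -[_ *: _]addr0; apply: UL.
have UD p q : U p -> U q -> U (p + q).
  by move=> hp hq; rewrite -[p]scale1r; apply: UL.
have UB p q : U p -> U q -> U (p - q).
  by move=> hp hq; apply: UD => //; rewrite -scaleN1r; apply: UZ.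
pose red p := forall u, U u -> u != 0 -> p@_(mlead u) = 0.
have uniq p q : red p -> red q -> U (p - q) -> p = q.
  move=> rp rq h; apply/eqP; rewrite -subr_eq0; apply/negPn/negP => nz.
  by move: (nz); rewrite -mleadc_eq0 mcoeffB rp // rq // subrr eqxx.
have exr p : exists r, U (p - r) /\ red r.
  elim/mleadrect: p => p IH.
  have [->|nzp] := eqVneq p 0.
    by exists 0; rewrite subrr; split=> // u _ _; rewrite mcoeff0.
  have [[u [hu nzu lu]]|no] := classic (exists u, [/\ U u, u != 0 & mlead u = mlead p]).
    pose q := (mleadc p / mleadc u) *: u.
    have nzc : mleadc p / mleadc u != 0 by rewrite mulf_neq0 ?invr_eq0 ?mleadc_eq0.
    have lq : mlead q = mlead p by rewrite mleadZ.
    have [e|nz] := eqVneq (p - q) 0.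
      exists 0; rewrite subr0; split; last by move=> ? _ _; rewrite mcoeff0.
      by move/eqP: e; rewrite subr_eq0 => /eqP ->; apply: UZ.
    have [|r [h rr]] := IH (p - q).
      by apply: mlead_sub_lt => //; rewrite lq mcoeffZ -{3}lu divfK // mleadc_eq0.
    exists r; split=> //; have -> : p - r = (p - q - r) + q by ring.
    by apply: UD => //; apply: UZ.
  pose q := p - mleadc p *: 'X_[mlead p].
  have redX : red (mleadc p *: 'X_[mlead p]).
    move=> u hu nzu; rewrite mcoeffZ mcoeffX; case: eqP => [e|]; last by rewrite mulr0.
    by case: no; exists u.
  have [e|nz] := eqVneq q 0.
    exists p; rewrite subrr; split=> //.
    by move/eqP: e; rewrite subr_eq0 => /eqP ->.
  have [|r [h rr]] := IH q; first exact: ltm_mleadD.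
  exists (r + mleadc p *: 'X_[mlead p]); split.
    by rewrite opprD addrA addrAC.
  by move=> u hu nzu; rewrite mcoeffD rr // redX // addr0.
have [nf nfP] := functional_choice exr.
exists (fun p => p - nf p); split=> [p|p hp|c p q]; first by case: (nfP p).
  have [h r] := nfP p; rewrite (uniq (nf p) 0) ?subr0 //.
    by move=> u _ _; rewrite mcoeff0.
  by rewrite -[nf p](subKr p); apply: UB.
have -> : nf (c *: p + q) = c *: nf p + nf q.
  have [h1 r1] := nfP p; have [h2 r2] := nfP q; have [h3 r3] := nfP (c *: p + q).
  apply: uniq => //.
    by move=> u hu nzu; rewrite mcoeffD mcoeffZ r1 // r2 // mulr0 addr0.
  have -> : nf (c *: p + q) - (c *: nf p + nf q) =
      (c *: (p - nf p) + (q - nf q)) - (c *: p + q - nf (c *: p + q)).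
    by rewrite scalerBr; ring.
  by apply: UB => //; apply: UL.
by rewrite scalerBr; ring.
Qed.

End MpolyField.

(** * Separating by differential operators *)

Section MonomialSums.
Variables (A : comNzRingType) (d : nat) (phi : 'X_{1..d} -> A).

(** The linear extension of [phi] from monomials; it serves both for functionals on [S[Y]] and for
    operators applied to a fixed polynomial. *)
Definition msum (G : {mpoly A[d]}) : A := \sum_(m <- msupp G) G@_m * phi m.

Lemma msumwE (G : {mpoly A[d]}) b : (msize G <= b)%N ->
  msum G = \sum_(m : 'X_{1..d < b}) G@_m * phi m.
Proof.
move=> le; rewrite /msum (big_mksub 'X_{1..d < b}) ?msupp_uniq //=; first last.
  by move=> x /msize_mdeg_lt /leq_trans; apply.
by rewrite big_rmcond //= => j /memN_msupp_eq0 ->; rewrite mul0r.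
Qed.

Lemma msumP c G H : msum (c *: G + H) = c * msum G + msum H.
Proof.
pose b := (msize (c *: G + H)%R + msize G + msize H)%N.
rewrite !(@msumwE _ b) /b ?leq_addl // -?addnA ?leq_addr //; last first.
  by rewrite addnCA leq_addr.
rewrite mulr_sumr -big_split; apply: eq_bigr => m _ /=.
by rewrite mcoeffD mcoeffZ mulrDl mulrA.
Qed.

Lemma msum0 : msum 0 = 0.
Proof. by rewrite /msum msupp0 big_nil. Qed.

Lemma msumD G H : msum (G + H) = msum G + msum H.
Proof. by rewrite -{1}[G]scale1r msumP mul1r. Qed.

Lemma msumZ c G : msum (c *: G) = c * msum G.
Proof. by rewrite -[c *: G]addr0 msumP msum0 addr0. Qed.

Lemma msumN G : msum (- G) = - msum G.
Proof. by rewrite -scaleN1r msumZ mulN1r. Qed.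

Lemma msumB G H : msum (G - H) = msum G - msum H.
Proof. by rewrite msumD msumN. Qed.

Lemma msum_sum (T : Type) (r : seq T) (p : pred T) (E : T -> {mpoly A[d]}) :
  msum (\sum_(i <- r | p i) E i) = \sum_(i <- r | p i) msum (E i).
Proof. exact: (big_morph msum msumD msum0). Qed.

Lemma msumX m : msum 'X_[m] = phi m.
Proof. by rewrite /msum msuppX big_seq1 mcoeffX eqxx mul1r. Qed.

End MonomialSums.

Lemma taylor_remainder (A : comNzRingType) (x z : A) b N : exists w,
  (x + z) ^+ b = \sum_(a < N) ('C(b, a))%:R * x ^+ (b - a) * z ^+ a + z ^+ N * w.
Proof.
pose f a := ('C(b, a))%:R * x ^+ (b - a) * z ^+ a.
have f0 a : (b < a)%N -> f a = 0 by move=> h; rewrite /f bin_small // !mul0r.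
(* The extra binomials vanish, and the longer range can be split at [N] whether or not [N] exceeds
   [b]. *)
have e : (x + z) ^+ b = \sum_(a < N + b.+1) f a.
  rewrite addnC big_split_ord /= [X in _ = _ + X]big1 ?addr0; last first.
    by move=> i _; rewrite f0 // leq_addr.
  by rewrite exprDn; apply: eq_bigr => a _; rewrite /f -mulr_natl mulrA.
exists (\sum_(a < b.+1) ('C(b, N + a))%:R * x ^+ (b - (N + a)) * z ^+ a).
rewrite e big_split_ord /= mulr_sumr; congr (_ + _); apply: eq_bigr => a _.
by rewrite /f exprD; ring.
Qed.

Lemma horner_cofactor (A : comNzRingType) (p q : {poly A}) c x :
  p - c%:P = q * ('X - x%:P) -> q.[x] = p^`().[x].
Proof.
move=> /(congr1 (fun r => r^`().[x])).
rewrite derivB derivC subr0 derivM derivB derivX derivC subr0 mulr1.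
by rewrite hornerD hornerM hornerXsubC subrr mulr0 add0r => ->.
Qed.

(** * Differential operators from linear functionals *)

Section Duality.
Variables (F : fieldType) (d : nat).
Hypothesis char0 : [pchar F] =i pred0.

(** [SY] is [S[Y]], with [Y] a second copy of the variables [y]: [iota] substitutes [Y] for [y],
    [ev] substitutes [y] for [Y], and [Z i] is [Y_i - y_i]. *)
Local Notation S := {mpoly F[d]}.
Local Notation SY := {mpoly {mpoly F[d]}[d]}.
Local Notation iota := (map_mpoly (@mpolyC d F) : S -> SY).
Local Notation ev := (@meval d {mpoly F[d]} (fun i => 'X_i)).
Local Notation Z i := ('X_i - ('X_i)%:MP : SY).

Implicit Types (M L J : S -> Prop).

Lemma natf_neq0_char0 k : (k.+1%:R : F) != 0.
Proof. by have/pcharf0P -> := char0. Qed.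

Lemma deriv_neq0 (p : {poly F}) : (1 < size p)%N -> p^`() != 0.
Proof.
move=> sp; apply/eqP => /(congr1 (fun q : {poly F} => q`_(size p).-2)) /eqP.
rewrite coef_deriv coef0 -mulr_natr mulf_eq0 (negbTE (natf_neq0_char0 _)) orbF.
have -> : (size p).-2.+1 = (size p).-1 by case: (size p) sp => [|[]].
by rewrite -[_`_ _]/(lead_coef p) lead_coef_eq0 => /eqP p0; rewrite p0 size_poly0 in sp.
Qed.

Local Notation peval p x := ((map_poly (@mpolyC d F) p).[x]).

(** As long as the derivative is also a relation it replaces [p]: it is nonzero in characteristic 0
    and of smaller degree. Constants are excluded since [M] is proper. *)
Lemma exists_separable_relation M x : is_prime_ideal M ->
  (exists2 p : {poly F}, p != 0 & M (peval p x)) ->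
  exists2 p : {poly F}, M (peval p x) & ~ M (peval p^`() x).
Proof.
move=> [hM M1 _] [p]; move: {2}(size p) (leqnn (size p)) => k.
elim: k p => [p|k IH p sp nz hp].
  by rewrite leqn0 size_poly_eq0 => ->.
have [hp'|] := classic (M (peval p^`() x)); last by exists p.
have [s1|s1] := leqP (size p) 1.
  case: M1; move: nz hp; rewrite (size1_polyC s1) polyC_eq0 => nz.
  rewrite map_polyC hornerC /= => h.
  by rewrite -(mpolyC1 d F) -(mulVf nz) mpolyCM; apply: idealMl.
apply: (IH p^`()) => //; last exact: deriv_neq0.
by rewrite -ltnS; apply: leq_trans sp; apply: lt_size_deriv.
Qed.

Lemma iotaC c : iota c%:MP = c%:MP%:MP.
Proof. exact: map_mpolyC. Qed.

Lemma evX m : ev 'X_[m] = 'X_[m].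
Proof. by rewrite mevalX mpolyXE_id. Qed.

Lemma ev_horner (q : {poly S}) i :
  ev (map_poly (@mpolyC d {mpoly F[d]}) q).['X_i] = q.['X_i].
Proof.
elim/poly_ind: q => [|q c IH]; first by rewrite raddf0 !horner0 raddf0.
rewrite rmorphD rmorphM /= map_polyX map_polyC /= !hornerMXaddC.
by rewrite mevalD mevalM IH mevalXU mevalC.
Qed.

Lemma iota_horner (p : {poly F}) i : iota (peval p 'X_i) =
  (map_poly (@mpolyC d {mpoly F[d]}) (map_poly (@mpolyC d F) p)).['X_i].
Proof.
elim/poly_ind: p => [|p c IH]; first by rewrite !raddf0 !horner0 raddf0.
rewrite rmorphD rmorphM /= map_polyX map_polyC /=.
rewrite rmorphD rmorphM /= map_polyX map_polyC /= !hornerMXaddC.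
by rewrite -IH rmorphD rmorphM /= map_mpolyX iotaC.
Qed.

(* [ev q] is the value at ['X_i] of the derivative of the relation. *)
Lemma exists_separable_factor M i : is_prime_ideal M ->
  (exists2 p : {poly F}, p != 0 & M (peval p 'X_i)) ->
  exists (p : S) (q : SY), [/\ M p, ~ M (ev q) &
    iota p - p%:MP = q * ('X_i - ('X_i)%:MP)].
Proof.
move=> pM /(exists_separable_relation pM) [p hp hp'].
pose ph := map_poly (@mpolyC d F) p.
have [q eq] : exists q, ph - (ph.['X_i])%:P = q * ('X - ('X_i)%:P).
  by apply/factor_theorem; rewrite rootE hornerD hornerN hornerC subrr.
exists ph.['X_i], (map_poly (@mpolyC d {mpoly F[d]}) q).['X_i]; split=> //.
  by rewrite ev_horner (horner_cofactor eq) /ph deriv_map.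
rewrite iota_horner.
have /(congr1 (fun r => (map_poly (@mpolyC d {mpoly F[d]}) r).['X_i])) := eq.
rewrite rmorphB rmorphM rmorphB /= map_polyX !map_polyC /=.
by rewrite hornerD hornerN hornerC hornerM hornerXsubC => <-.
Qed.

(** Project onto [L + (h)] and read off a coefficient of [h]. It is determined only modulo [L : h],
    hence modulo [M], so linearity holds up to [M]. *)
Lemma exists_functional M L h : is_ideal M -> is_ideal L ->
  (forall u, L (u * h) -> M u) ->
  exists l : S -> S, [/\ forall c p q, M (l (c *: p + q) - (c *: l p + l q)),
    forall x, L x -> M (l x) & forall s, M (l (s * h) - s)].
Proof.
move=> hM hL LM; have hA := adjoin_ideal h hL.
have [|c p q hp hq|pi [pi1 pi2 pi3]] := subspace_projection (U := adjoin L h).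
- exact: ideal0.
- by apply: idealD => //; rewrite -mul_mpolyC; apply: idealMl.
have ex p : exists b, L (pi p - b * h).
  by have [a [b [ha ->]]] := pi1 p; exists b; rewrite addrK.
have [l hl] := functional_choice ex.
exists l; split=> [c p q|x hx|s]; apply: LM.
- have -> : (l (c *: p + q) - (c *: l p + l q)) * h =
    c%:MP * (pi p - l p * h) + (pi q - l q * h) -
      (pi (c *: p + q) - l (c *: p + q) * h).
    by rewrite pi3 -!mul_mpolyC; ring.
  by apply: idealB => //; apply: idealD => //; apply: idealMl.
- have := hl x; rewrite pi2 => [hx'|]; last exact: sub_adjoin.
  by rewrite -[l x * h](subKr x); apply: idealB.
- have := hl (s * h); rewrite pi2 => [hx'|]; last by apply: idealMl => //; apply: mem_adjoin.
  by rewrite mulrBl -opprB; apply: idealN.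
Qed.

(* [Lam] plays the role of a [kappa(M)]-linear functional on
   [kappa(M)[Y]], with values lifted to [S]. *)
Lemma exists_extended_functional M L h : is_ideal M -> is_ideal L ->
  (forall u, L (u * h) -> M u) ->
  exists phi : 'X_{1..d} -> S, let Lam := msum phi in
    (forall x G, L x -> M (Lam (iota x * G))) /\
    (forall G, M (Lam (iota h * G) - ev G)).
Proof.
move=> hM hL LM; have [l [l1 l2 l3]] := exists_functional hM hL LM.
exists (fun m => l 'X_[m]) => Lam.
have l0 : M (l 0).
  have := l1 1 0 0; rewrite scaler0 addr0 scale1r opprD addrA subrr add0r.
  by move/(idealN hM); rewrite opprK.
have Lamiota f : M (Lam (iota f) - l f).
  elim/mpolyind: f => [|c m p _ _ IH].
    by rewrite raddf0 /Lam msum0 sub0r; apply: idealN.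
  rewrite raddfD /= map_mpolyZ map_mpolyX /Lam msumP msumX -/Lam.
  have -> : c%:MP * l 'X_[m] + Lam (iota p) - l (c *: 'X_[m] + p) =
    (Lam (iota p) - l p) - (l (c *: 'X_[m] + p) - (c *: l 'X_[m] + l p)).
    by rewrite -!mul_mpolyC; ring.
  exact: idealB.
split=> [x G hx|G]; elim/mpolyind: G => [|c m p _ _ IH].
- by rewrite mulr0 /Lam msum0; apply: ideal0.
- rewrite mulrDr -scalerAr /Lam msumP -/Lam; apply: idealD => //; apply: idealMl => //.
  have -> : iota x * 'X_[m] = iota (x * 'X_[m]) by rewrite rmorphM /= map_mpolyX.
  rewrite -[Lam _](subrK (l (x * 'X_[m]))); apply: idealD => //.
  by apply: l2; apply: idealMr.
- by rewrite mulr0 /Lam msum0 raddf0 subr0; apply: ideal0.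
- rewrite mulrDr -scalerAr /Lam msumP -/Lam mevalD mevalZ evX.
  have -> : iota h * 'X_[m] = iota ('X_[m] * h).
    by rewrite mulrC rmorphM /= map_mpolyX.
  have -> : c * Lam (iota ('X_[m] * h)) + Lam (iota h * p) -
      (c * 'X_[m] + ev p) =
    c * ((Lam (iota ('X_[m] * h)) - l ('X_[m] * h)) + (l ('X_[m] * h) - 'X_[m])) +
    (Lam (iota h * p) - ev p) by ring.
  by apply: idealD => //; apply: idealMl => //; apply: idealD.
Qed.

(** The same sum as in [apply_dual], in the form to which linearity of [msum] applies. *)
Definition dual_action (D : SY) (g : S) : S := msum (fun m => g^`M[m]) D.

Definition ffun_mnm N (a : {ffun 'I_d -> 'I_N}) : 'X_{1..d} := [multinom (a i : nat) | i < d].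

(** By Taylor's formula, the operator attached to a functional with value [V a] on the product of
    the [Z i ^+ a i]. Exponents are finite functions so that products of sums expand by
    distributivity. *)
Definition taylor_operator N (V : {ffun 'I_d -> 'I_N} -> S) : SY :=
  \sum_(a : {ffun 'I_d -> 'I_N}) (((\prod_(i < d) (a i)`!)%:R^-1)%:MP * V a) *: 'X_[ffun_mnm a].

Lemma dual_action_taylor N (V : {ffun 'I_d -> 'I_N} -> S) g :
  dual_action (taylor_operator V) g =
  \sum_(a : {ffun 'I_d -> 'I_N}) ((\prod_(i < d) (a i)`!)%:R^-1)%:MP * V a * g^`M[ffun_mnm a].
Proof.
rewrite /dual_action msum_sum; apply: eq_bigr => a _.
by rewrite msumZ msumX.
Qed.

(** Dividing by the factorials turns the falling factorials of the derivative into Taylor's binomial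
    coefficients. *)
Lemma mderivm_ffun_mnm N (a : {ffun 'I_d -> 'I_N}) m :
  ((\prod_(i < d) (a i)`!)%:R^-1)%:MP * ('X_[F, m])^`M[ffun_mnm a] =
  \prod_(i < d) (('C(m i, a i))%:R * 'X_i ^+ (m i - a i)).
Proof.
rewrite mderivmX mpolyXE_id -mul_mpolyC mulrA -mpolyCM.
have -> : (\prod_(i < d) m i ^_ (ffun_mnm a i))%N =
   ((\prod_(i < d) 'C(m i, a i)) * (\prod_(i < d) (a i)`!))%N.
  by rewrite -big_split; apply: eq_bigr => i _ /=; rewrite mnmE bin_ffact.
rewrite natrM [_^-1 * _]mulrC mulfK; last first.
  by rewrite -(prednK (prodn_gt0 (fun i => fact_gt0 _))) natf_neq0_char0.
rewrite natr_prod rmorph_prod -big_split; apply: eq_bigr => i _ /=.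
by rewrite mpolyC_nat mnmBE mnmE.
Qed.

Lemma taylor_truncated (Null : SY -> Prop) N m : is_ideal Null ->
  (forall i, Null (Z i ^+ N)) ->
  Null (iota 'X_[m] - \sum_(a : {ffun 'I_d -> 'I_N})
     (\prod_(i < d) (('C(m i, a i))%:R * 'X_i ^+ (m i - a i)))%:MP *
     \prod_(i < d) Z i ^+ a i).
Proof.
move=> hN hZ.
pose f i (a : 'I_N) : SY := (('C(m i, a))%:R * 'X_i ^+ (m i - a))%:MP * Z i ^+ a.
have -> : \sum_(a : {ffun 'I_d -> 'I_N})
     (\prod_(i < d) (('C(m i, a i))%:R * 'X_i ^+ (m i - a i)))%:MP *
     \prod_(i < d) Z i ^+ a i = \prod_(i < d) \sum_(a < N) f i a.
  rewrite bigA_distr_bigA; apply: eq_bigr => a _.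
  by rewrite rmorph_prod -big_split.
rewrite map_mpolyX mpolyXE_id; apply: ideal_prod_sub => // i.
have [w ew] := taylor_remainder (('X_i)%:MP : SY) (Z i) (m i) N.
have -> : 'X_i ^+ m i - \sum_(a < N) f i a = Z i ^+ N * w.
  rewrite addrC subrK in ew; rewrite ew; set s := \sum_(a < N) f i a.
  suff -> : \sum_(a < N) ('C(m i, a))%:R * ('X_i)%:MP ^+ (m i - a) * Z i ^+ a = s.
    by rewrite addrC addKr.
  by apply: eq_bigr => a _; rewrite /f mpolyCM mpolyC_nat rmorphXn.
exact: idealMr.
Qed.

(** The [G] such that [msum phi] sends every multiple of [Q * G] into [M] form an ideal containing
    each [Z i ^+ N]; Taylor's expansion modulo this ideal handles monomials. *)
Lemma functional_taylor M (phi : 'X_{1..d} -> S) (Q : SY) N : is_ideal M ->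
  (forall i H, M (msum phi (Q * Z i ^+ N * H))) -> forall f,
  M (dual_action (taylor_operator (N := N)
       (fun a => msum phi (Q * \prod_(i < d) Z i ^+ a i))) f
     - msum phi (Q * iota f)).
Proof.
move=> hM hZ f; set Lam := msum phi; set V := fun a => Lam _.
pose Null G := forall H, M (Lam (Q * G * H)).
have NullI : is_ideal Null.
  split=> [H|G G' h h' H|G G' h H].
  - by rewrite mulr0 mul0r /Lam msum0; apply: ideal0.
  - by rewrite mulrDr mulrDl /Lam msumD; apply: idealD.
  - by have -> : Q * (G * G') * H = Q * G' * (G * H); [ring | apply: h].
elim/mpolyind: f => [|c m f _ _ IH].
  rewrite dual_action_taylor raddf0 mulr0 /Lam msum0 subr0 big1 => [|a _].
    exact: ideal0.
  by rewrite raddf0 mulr0.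
have -> : dual_action (taylor_operator V) (c *: 'X_[m] + f) =
    c%:MP * dual_action (taylor_operator V) 'X_[m] + dual_action (taylor_operator V) f.
  rewrite !dual_action_taylor mulr_sumr -big_split; apply: eq_bigr => a _ /=.
  by rewrite mderivmD mderivmZ -[c *: _]mul_mpolyC; ring.
have -> : Q * iota (c *: 'X_[m] + f) = c%:MP *: (Q * iota 'X_[m]) + Q * iota f.
  by rewrite raddfD /= [LHS]mulrDr map_mpolyZ -scalerAr.
rewrite /Lam msumP -/Lam; apply: (ideal_lincomb_sub _ hM _ IH).
rewrite dual_action_taylor.
have := taylor_truncated m NullI hZ 1; rewrite mulr1 mulrBr /Lam msumB -/Lam.
move/(idealN hM); rewrite opprB mulr_sumr /Lam msum_sum -/Lam.
congr (M (_ - _)); apply: eq_bigr => a _.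
by rewrite [RHS]mulrAC mderivm_ffun_mnm [X in Lam X]mulrCA mul_mpolyC /Lam msumZ.
Qed.

Lemma exists_dual_operator M J g : is_prime_ideal M -> is_ideal J ->
  (forall i : 'I_d, exists2 p : {poly F}, p != 0 &
     M ((map_poly (@mpolyC d F) p).['X_i])) ->
  ~ contraction (fun s => ~ M s) J g ->
  exists D : SY, (forall f, J f -> M (dual_action D f)) /\ ~ M (dual_action D g).
Proof.
move=> pM hJ alg ng; have [hM M1 MM] := pM.
have [L [hL JL nil LM]] :=
  exists_primary_avoiding (@mpoly_noetherian F d) pM hJ ng.
have [phi [Lam1 Lam2]] := exists_extended_functional hM hL LM.
set Lam := msum phi in Lam1 Lam2.
have exq (i : 'I_d) : exists pq : S * SY, [/\ M pq.1, ~ M (ev pq.2) &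
    iota pq.1 - pq.1%:MP = pq.2 * Z i].
  by have [p [q h]] := exists_separable_factor pM (alg i); exists (p, q).
have [pq hpq] := functional_choice exq.
pose p i := (pq i).1; pose q i := (pq i).2.
have exN (i : 'I_d) : exists k, L (p i ^+ k) by apply: nil; case: (hpq i).
have [Ni hNi] := functional_choice exN.
(* A common exponent for all [i]. *)
pose N := (\sum_i Ni i)%N.
have hN i : L (p i ^+ N).
  by rewrite /N (bigD1 i) //= exprD; apply: idealMr.
pose Q : SY := \prod_i q i ^+ N.
(* [(q i * Z i) ^+ N] is the power of a difference [a - b]: multiples of [b] have coefficients in
   [M], and [a ^+ N] is the image of an element of [L]. *)
have NullZ i H : M (Lam (Q * Z i ^+ N * H)).
  have [Mp _ e] := hpq i; rewrite -/(p i) -/(q i) in Mp e.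
  rewrite /Q (bigD1 i) //=; set Q' := \prod_(j | _) _.
  have -> : q i ^+ N * Q' * Z i ^+ N * H = (q i * Z i) ^+ N * (Q' * H).
    by rewrite exprMn; ring.
  rewrite -e; set a := iota (p i); set b := (p i)%:MP; set K := Q' * H.
  have [w ew] : exists w, (a - b) ^+ N = a ^+ N - b * w.
    exists (\sum_(j < N) (a - b) ^+ (N.-1 - j) * a ^+ j).
    rewrite -[LHS](subrK (a ^+ N)) subrXX.
    have -> : a - b - a = - b by ring.
    by rewrite mulNr addrC.
  rewrite ew mulrBl /Lam msumB -/Lam; apply: idealB => //.
    by rewrite -rmorphXn; apply: Lam1.
  by rewrite -mulrA mul_mpolyC /Lam msumZ; apply: idealMr.
have key := functional_taylor hM NullZ; rewrite -/Lam in key.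
exists (taylor_operator (N := N) (fun a => Lam (Q * \prod_(i < d) Z i ^+ a i))).
split=> [f Jf|hg].
  apply: (ideal_of_sub hM (key f)); rewrite mulrC; apply: Lam1.
  exact: JL.
(* The value of the operator at [g] is [ev Q] modulo [M], a product of factors outside the prime
   [M]. *)
have : M (ev Q).
  apply: (ideal_of_sub_r hM (Lam2 Q)); rewrite mulrC.
  exact: (ideal_of_sub_r hM (key g)).
rewrite /Q rmorph_prod /=; suff : ~ M (\prod_i ev (q i ^+ N)) by [].
elim/big_rec: _ => // i x _ nx /MM [|//].
by rewrite rmorphXn => /(prime_expr pM); case: (hpq i).
Qed.

End Duality.

(** * Extension to [K(t)[y]] *)

Lemma fraction_clear (A : idomainType) (a : {fraction A}) :
  exists c b : A, c != 0 /\ FracField.tofrac c * a = FracField.tofrac b.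
Proof.
exists (\d_(repr a)), (\n_(repr a)); split; first exact: denom_ratioP.
rewrite -{2}[a]reprK; unlock FracField.tofrac; rewrite -[LHS]FracField.pi_mul.
apply/eqP; rewrite FracField.equivf_def /FracField.mulf /=.
rewrite !numden_Ratio ?mulf_neq0 ?oner_eq0 ?denom_ratioP //.
by rewrite !mulr1 mul1r.
Qed.

Section Extension.
Variables (K : fieldType) (n k : nat).
Variables (t : 'I_k -> {mpoly K[n]}) (y : 'I_(n - k) -> {mpoly K[n]}).

Local Notation R := {mpoly K[n]}.
Local Notation tmap := (mmap (@mpolyC n K) t).
Local Notation coord := (coord_map t y).
Local Notation ext := (@ext_map K n k).
Local Notation tofrac := (@FracField.tofrac {mpoly K[k]}).
Local Notation C := (@mpolyC (n - k) {mpoly K[k]}).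

Implicit Types (I J P : R -> Prop) (G : Cring K n k) (s : Sring K n k).

Lemma coordM G G' : coord (G * G') = coord G * coord G'.
Proof. exact: (rmorphM (mmap tmap y)). Qed.

Lemma coordD G G' : coord (G + G') = coord G + coord G'.
Proof. exact: (rmorphD (mmap tmap y)). Qed.

Lemma coord0 : coord 0 = 0.
Proof. exact: (rmorph0 (mmap tmap y)). Qed.

Lemma coord1 : coord 1 = 1.
Proof. exact: (rmorph1 (mmap tmap y)). Qed.

Lemma coordC c : coord (C c) = tmap c.
Proof. exact: (mmapC y tmap). Qed.

Lemma coordX i : coord 'X_i = y i.
Proof. by rewrite /coord_map mmapX mmap1U. Qed.

Lemma extM G G' : ext (G * G') = ext G * ext G'.
Proof. exact: (rmorphM (map_mpoly tofrac)). Qed.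

Lemma extD G G' : ext (G + G') = ext G + ext G'.
Proof. exact: (rmorphD (map_mpoly tofrac)). Qed.

Lemma ext0 : ext 0 = 0.
Proof. exact: (rmorph0 (map_mpoly tofrac)). Qed.

Lemma ext1 : ext 1 = 1.
Proof. exact: (rmorph1 (map_mpoly tofrac)). Qed.

Lemma extC c : ext (C c) = (tofrac c)%:MP.
Proof. exact: map_mpolyC. Qed.

Lemma extX m : ext 'X_[m] = 'X_[m].
Proof. exact: map_mpolyX. Qed.

Lemma mcoeff_ext G m : (ext G)@_m = tofrac G@_m.
Proof. exact: mcoeff_map_mpoly. Qed.

Lemma ext_inj : injective ext.
Proof.
move=> G G' e; apply/mpolyP => m; apply/eqP; rewrite -tofrac_eq; apply/eqP.
exact: etrans (esym (mcoeff_ext G m)) (etrans (congr1 (mcoeff m) e) (mcoeff_ext G' m)).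
Qed.

(** A relation, since a fraction [G / c] representing [s] is not unique. *)
Definition clears (c : {mpoly K[k]}) G s := c != 0 /\ (tofrac c)%:MP * s = ext G.

Lemma clears_exists s : exists c G, clears c G s.
Proof.
elim/mpolyind: s => [|a m p _ _ [c [G [nzc e]]]].
  by exists 1, 0; split; rewrite ?oner_neq0 // mulr0 ext0.
have [c' [b [nzc' e']]] := fraction_clear a.
exists (c' * c), (C (c * b) * 'X_[m] + C c' * G); split; first exact: mulf_neq0.
rewrite extD !extM !extC extX -e !rmorphM /= -e' -mul_mpolyC rmorphM /=.
by ring.
Qed.

Lemma clearsM c G s c' G' s' :
  clears c G s -> clears c' G' s' -> clears (c * c') (G * G') (s * s').
Proof.
move=> [nzc e] [nzc' e']; split; first exact: mulf_neq0.
by rewrite extM -e -e' !rmorphM /=; ring.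
Qed.

Lemma clears_ext G : clears 1 G (ext G).
Proof. by split; [exact: oner_neq0 | rewrite tofrac1 mpolyC1 mul1r]. Qed.

Lemma clears_unique c G c' G' s :
  clears c G s -> clears c' G' s -> C c' * G = C c * G'.
Proof.
move=> [_ e] [_ e']; apply: ext_inj.
by rewrite !extM !extC -e -e'; ring.
Qed.

(** Fractions with numerator from [I] and nonzero denominator in [K[t]] already form an ideal. *)
Lemma ext_idealP I s : is_ideal I ->
  ext_ideal t y I s <-> exists c G, clears c G s /\ I (coord G).
Proof.
move=> hI; split.
- move=> h; apply: (h (fun s => exists c G, clears c G s /\ I (coord G))).
  + split.
    * exists 1, 0; split; first by rewrite -ext0; apply: clears_ext.
      by rewrite coord0; apply: ideal0.
    * move=> u v [c [G [[nzc e] hG]]] [c' [G' [[nzc' e'] hG']]].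
      exists (c * c'), (C c' * G + C c * G'); split.
        split; first exact: mulf_neq0.
        by rewrite extD !extM !extC -e -e' rmorphM /= rmorphM /=; ring.
      by rewrite coordD !coordM; apply: idealD => //; apply: idealMl.
    * move=> r u [c [G [hc hG]]]; have [c' [G' hc']] := clears_exists r.
      exists (c' * c), (G' * G); split; first exact: clearsM.
      by rewrite coordM; apply: idealMl.
  + move=> _ [G [hG ->]]; exists 1, G; split=> //; exact: clears_ext.
- move=> [c [G [[nzc e] hG]]] L hL h.
  have -> : s = ((tofrac c)^-1)%:MP * ext G.
    by rewrite -e mulrA -mpolyCM mulVf ?tofrac_eq0 // mpolyC1 mul1r.
  by apply: idealMl => //; apply: h; exists G.
Qed.

Lemma ext_ideal_ideal I : is_ideal (ext_ideal t y I).
Proof.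
split=> [L hL _|u v hu hv L hL h|r u hu L hL h]; first exact: ideal0.
- by apply: idealD => //; [apply: hu | apply: hv].
- by apply: idealMl => //; apply: hu.
Qed.

Lemma mem_ext_ideal I G : I (coord G) -> ext_ideal t y I (ext G).
Proof. by move=> hG L hL h; apply: h; exists G. Qed.

Section PrimeExtension.
Variable P : R -> Prop.
Hypotheses (pP : is_prime_ideal P) (freeP : free_vars t P).

(** Cross-multiply with a fraction whose numerator is in [P]: by algebraic independence of [t],
    nonzero denominators stay outside [P]. *)
Lemma ext_prime_clears c G s : clears c G s -> ext_ideal t y P s -> P (coord G).
Proof.
have [hP _ PM] := pP; move=> cs /(ext_idealP _ hP) [c' [G' [cs' hG']]].
have [nzc' _] := cs'; have := congr1 coord (clears_unique cs cs').
rewrite !coordM !coordC => e.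
have : P (tmap c' * coord G) by rewrite e; apply: idealMl.
by case/PM => [/(proj1 freeP) c0|//]; rewrite c0 eqxx in nzc'.
Qed.

Lemma ext_ideal_prime : is_prime_ideal (ext_ideal t y P).
Proof.
have [hP P1 PM] := pP; split; first exact: ext_ideal_ideal.
  move=> h; apply: P1; rewrite -coord1; apply: (ext_prime_clears (clears_ext 1)).
  by rewrite ext1.
move=> a b hab; have [c [G ha]] := clears_exists a; have [c' [G' hb]] := clears_exists b.
have := ext_prime_clears (clearsM ha hb) hab; rewrite coordM => /PM [h|h]; [left|right].
  by apply/ext_idealP => //; exists c, G.
by apply/ext_idealP => //; exists c', G'.
Qed.

(** The relation of [y i] over [K[t]] modulo [P], read over [K(t)], as [exists_dual_operator]
    requires. *)
Lemma ext_ideal_algebraic i : exists2 p : {poly Kt K k}, p != 0 &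
  ext_ideal t y P ((map_poly (@mpolyC (n - k) (Kt K k)) p).['X_i]).
Proof.
have [c [nzc hc]] := proj2 freeP (y i).
exists (map_poly tofrac c).
  by rewrite map_poly_eq0_id0 // tofrac_eq0 lead_coef_eq0.
have -> : (map_poly (@mpolyC (n - k) (Kt K k)) (map_poly tofrac c)).['X_i] =
    ext (map_poly C c).['X_i].
  elim/poly_ind: c {nzc hc} => [|c a IH].
    by rewrite !raddf0 !horner0 ext0.
  rewrite rmorphD rmorphM /= map_polyX map_polyC /=.
  rewrite rmorphD rmorphM /= map_polyX map_polyC /= hornerMXaddC IH.
  rewrite rmorphD rmorphM /= map_polyX map_polyC /= hornerMXaddC.
  by rewrite extD extM extX extC.
apply: mem_ext_ideal.
suff -> : coord (map_poly C c).['X_i] = (map_poly tmap c).[y i] by [].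
elim/poly_ind: c {nzc hc} => [|c a IH]; first by rewrite !raddf0 !horner0 coord0.
rewrite rmorphD rmorphM /= map_polyX map_polyC /= hornerMXaddC.
rewrite rmorphD rmorphM /= map_polyX map_polyC /= hornerMXaddC.
by rewrite coordD coordM IH coordX coordC.
Qed.

(** A multiplier outside the extension of [P] has its numerators outside [P], and so are the
    denominators by freeness. *)
Lemma ext_contraction J G : is_ideal J ->
  contraction (fun s => ~ ext_ideal t y P s) (ext_ideal t y J) (ext G) ->
  contraction (fun r => ~ P r) J (coord G).
Proof.
have [hP P1 PM] := pP; move=> hJ [s ns /(ext_idealP _ hJ) [c [G' [cs hG']]]].
have [c' [H cH]] := clears_exists s.
have := congr1 coord (clears_unique (clearsM cH (clears_ext G)) cs).
rewrite !coordM !coordC => e; exists (tmap c * coord H).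
  case/PM => [/(proj1 freeP) c0|h]; first by case: cs; rewrite c0 eqxx.
  by apply/ns/ext_idealP => //; exists c', H.
by rewrite -mulrA e; apply: idealMl.
Qed.

(** The exponent is kept: each factor is replaced by a numerator in [P]. *)
Lemma ext_saturation J G : is_ideal J -> saturation J P (coord G) ->
  saturation (ext_ideal t y J) (ext_ideal t y P) (ext G).
Proof.
have [hP _ _] := pP; move=> hJ [N hN]; exists N => m hm.
have ex i : exists cG : {mpoly K[k]} * Cring K n k, clears cG.1 cG.2 (m i) /\ P (coord cG.2).
  by have /(ext_idealP _ hP) [c [H h]] := hm i; exists (c, H).
have [cG hcG] := functional_choice ex.
apply/ext_idealP => //.
exists (1 * \prod_(i < N) (cG i).1), (G * \prod_(i < N) (cG i).2); split.
  apply: clearsM; first exact: clears_ext.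
  elim/big_rec3: _ => [|i s H c _ h]; first by rewrite -ext1; apply: clears_ext.
  by apply: clearsM; [case: (hcG i) | exact: h].
rewrite coordM (big_morph coord coordM coord1); apply: hN => i.
by case: (hcG i).
Qed.

End PrimeExtension.
End Extension.

(** * Comparison of the ideals at an associated prime *)

Lemma fraction_mpoly_char0 (K : fieldType) k :
  [pchar K] =i pred0 -> [pchar (Kt K k)] =i pred0.
Proof.
move=> /pcharf0P h; apply/pcharf0P => m.
rewrite -(rmorph_nat (@FracField.tofrac {mpoly K[k]})) tofrac_eq0.
by rewrite -mpolyC_nat mpolyC_eq0 h.
Qed.

Lemma local_inclusion (K : fieldType) n (I J P : {mpoly K[n]} -> Prop) k
    (t : 'I_k -> {mpoly K[n]}) (y : 'I_(n - k) -> {mpoly K[n]})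
    (A : seq (dualop K n k)) f :
  [pchar K] =i pred0 -> is_ideal J -> is_prime_ideal P ->
  coord_system t y -> free_vars t P ->
  (forall a, a \in A -> dual_space (ext_ideal t y P) (ext_ideal t y I) a) ->
  excess_generators t y J P A ->
  I f -> saturation J P f -> exists2 s, ~ P s & J (s * f).
Proof.
move=> char0 hJ pP [inv _ invK] freeP AI [_ AJ] hf satf; apply: NNPP => nf.
(* Extension to [S] acts on expressions in [t] and [y], so [f] is written as the image of such a
   [G]. *)
rewrite -(invK f) in hf satf nf; set G := inv f in hf satf nf.
set M := ext_ideal t y P in AI AJ; have pM := ext_ideal_prime y pP freeP.
have hM : is_ideal M by case: pM.
have [|D [DJ nD]] := exists_dual_operator (fraction_mpoly_char0 k char0) pM
   (ext_ideal_ideal t y J) (ext_ideal_algebraic y freeP) (g := ext_map G).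
  by move/(ext_contraction pP freeP hJ).
have [lam [D' [hD' hdiff]]] := AJ D DJ.
apply: nD.
set B := \sum_(i < size A) lam i *: nth 0 A i in hdiff.
(* The first summand has coefficients in [M], [B] sends [I] into [M] through [A], and [D'] sends the
   saturation into [M]. *)
have e : D = (D - B - D') + B + D' by rewrite addrAC subrK subrK.
rewrite /dual_action e 2!msumD; apply: (idealD hM); last first.
  exact: hD' (ext_saturation pP hJ satf).
apply: (idealD hM).
  by rewrite /msum; apply: (ideal_sum _ hM) => m _; apply: (idealMr _ hM).
rewrite msum_sum; apply: (ideal_sum _ hM) => i _; rewrite msumZ; apply: (idealMl _ hM).
by apply: (AI _ (mem_nth 0 (ltn_ord i))); apply: mem_ext_ideal.
Qed.

(** Only associated primes of [J] are visited; exchanging [I] and [J] gives the reverse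
    inclusion. *)
Lemma inclusion_of_dual_data (K : fieldType) n (I J : {mpoly K[n]} -> Prop) :
  [pchar K] =i pred0 -> is_ideal I -> is_ideal J ->
  (forall P, is_assoc J P ->
     exists (k : nat) (t : 'I_k -> {mpoly K[n]}) (y : 'I_(n - k) -> {mpoly K[n]})
            (A : seq (dualop K n k)),
       [/\ coord_system t y, free_vars t P,
           excess_generators t y I P A & excess_generators t y J P A]) ->
  forall f, I f -> J f.
Proof.
move=> char0 hI hJ data f hf.
have noeth := @mpoly_noetherian K n.
apply: (ideal_mem_of_assoc noeth hJ) => P aP; move: P aP f hf.
apply: (assoc_ind noeth hJ) => P aP IH f hf; have pP := assoc_prime aP.
have [|s ns satf] := saturation_away_from_assoc noeth (f := f) hJ pP.
  by move=> Q aQ QP PQ; apply: IH.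
have [k [t [y [A [cs fv [AI _] exJ]]]]] := data P aP.
(* The multiple [s * f] stays in [I], so [A] still annihilates it. *)
have hsf : I (s * f) by apply: idealMl.
have [s' ns' hs'] := local_inclusion char0 hJ pP cs fv AI exJ hsf satf.
exists (s' * s); last by rewrite -mulrA.
exact: (proj2 (prime_mul_closed pP)).
Qed.

Theorem theorem3p2 (K : fieldType) (n : nat) (I J : {mpoly K[n]} -> Prop) :
  [pchar K] =i pred0 ->
  is_ideal I -> is_ideal J ->
  (forall P, is_assoc I P <-> is_assoc J P) ->
  (forall P, is_assoc I P ->
     exists (k : nat) (t : 'I_k -> {mpoly K[n]}) (y : 'I_(n - k) -> {mpoly K[n]})
            (A : seq (dualop K n k)),
       [/\ (k <= n)%N, coord_system t y, free_vars t P,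
           excess_generators t y I P A & excess_generators t y J P A]) ->
  forall f, I f <-> J f.
Proof.
move=> char0 hI hJ same data f; split.
- apply: inclusion_of_dual_data => // P /same /data [k [t [y [A [_ h1 h2 h3 h4]]]]].
  by exists k, t, y, A.
- apply: inclusion_of_dual_data => // P /data [k [t [y [A [_ h1 h2 h3 h4]]]]].
  by exists k, t, y, A.
Qed.
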